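(* Let $n\ge3$ and let $A\in\mathbb C^{n\times n}$ be the arrowhead matrix with diagonal entries $a_1,\dots,a_n$, last column $[b_1,\dots,b_{n-1},a_n]^T$, last row $[c_1,\dots,c_{n-1},a_n]$, and all other entries zero. Let $a_1,\dots,a_{n-1}$ be distinct, let $C\subset\mathbb C$ denote their convex hull, and let $J_0=\{j\in\{1,\dots,n-1\}\mid a_j\in\partial C\}$. Assume that either (a) $|b_j|\ge|c_j|$ for all $j=1,\dots,n-1$, or (b) $|c_j|\ge|b_j|$ for all $j=1,\dots,n-1$; assume furthermore that these inequalities are strict for all $j\in J_0$. Then $k(A)=2$.
   Context: For $A\in\mathbb C^{n\times n}$ let $f_A(x)=\langle Ax,x\rangle$ on the unit sphere of $\mathbb C^n$; the numerical range $W(A)$ is the image of $f_A$, and the Gau--Wu number $k(A)$ is the maximal number of orthonormal vectors $x_j\in\mathbb C^n$ with $f_A(x_j)\in\partial W(A)$. $\partial C$ is the topological boundary of $C$ in the plane $\mathbb C$. *)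

(* Defs.v *)
From HB Require Import structures.
From mathcomp Require Import all_boot all_order all_algebra.
From mathcomp Require Import complex.
From mathcomp Require Import all_classical all_reals all_analysis.

Set Implicit Arguments.
Unset Strict Implicit.
Unset Printing Implicit Defensive.

Import Order.TTheory GRing.Theory Num.Theory.
Local Open Scope classical_set_scope.
Local Open Scope ring_scope.
Local Open Scope complex_scope.

(* The alias [R[i]^o] is what carries the norm topology of the plane. *)
Definition boundary (R : realType) (S : set R[i]^o) : set R[i]^o :=
  closure S `\` S°.

(* [Rcomplex R] is the type [R[i]] seen as a vector space over [R], so that the
   coefficients of convex combinations are real. *)
Definition convex_hull (R : realType) (S : set R[i]) : set R[i] :=
  smallest (fun D : set R[i] => @convex_set R (Rcomplex R) D) S.

(* [dotmx] acts on row vectors; it is antilinear in its second argument. *)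
Definition inner (R : realType) (n : nat) (x y : 'cV[R[i]]_n) : R[i] :=
  dotmx x^T y^T.

Definition qform (R : realType) (n : nat) (A : 'M[R[i]]_n) (x : 'cV[R[i]]_n) :
  R[i] := inner (A *m x) x.

Definition numerical_range (R : realType) (n : nat) (A : 'M[R[i]]_n) :
  set R[i] := [set qform A x | x in [set x | inner x x = 1]].

Definition orthonormal_family (R : realType) (n k : nat)
    (x : 'I_k -> 'cV[R[i]]_n) : Prop :=
  forall i j, inner (x i) (x j) = (i == j)%:R.

Definition boundary_family (R : realType) (n : nat) (A : 'M[R[i]]_n) (k : nat) :
    Prop :=
  exists x : 'I_k -> 'cV[R[i]]_n, orthonormal_family x /\
    forall j, boundary (numerical_range A) (qform A (x j)).

(* Orthonormal families in C^n have at most n members, so bounding k by n loses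
   nothing: see [gau_wu_numberP]. *)
Definition gau_wu_number (R : realType) (n : nat) (A : 'M[R[i]]_n) : nat :=
  \max_(k < n.+1 | `[< boundary_family A k >]) k.

(* The matrix of order m + 1 with diagonal a_1, ..., a_m, an, last column
   b_1, ..., b_m, an and last row c_1, ..., c_m, an. *)
Definition arrowhead (R : realType) (m : nat) (a b c : 'I_m -> R[i])
    (an : R[i]) : 'M[R[i]]_(m + 1) :=
  block_mx (diag_mx (\row_j a j)) (\col_j b j)
           (\row_j c j)           an%:M.

Definition hull_boundary_indices (R : realType) (m : nat) (a : 'I_m -> R[i]) :
  set 'I_m := [set j | boundary (convex_hull (range a)) (a j)].

Lemma innerE (R : realType) (n : nat) (x y : 'cV[R[i]]_n) :
  inner x y = \sum_i x i 0 * (y i 0)^*.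
Proof.
by rewrite /inner dotmxE !mxE; apply: eq_bigr => i _; rewrite !mxE.
Qed.

Lemma orthonormal_family_leq (R : realType) (n k : nat)
  (x : 'I_k -> 'cV[R[i]]_n) : orthonormal_family x -> (k <= n)%N.
Proof.
move=> ox; pose X : 'M[R[i]]_(k, n) := \matrix_i (x i)^T.
have uX : X \is unitarymx.
  by apply/row_unitarymxP => i j; rewrite !rowK; exact: ox.
by rewrite -(mxrank_unitary uX) rank_leq_col.
Qed.

Lemma gau_wu_numberP (R : realType) (n : nat) (A : 'M[R[i]]_n) :
  boundary_family A (gau_wu_number A) /\
  (forall k, boundary_family A k -> (k <= gau_wu_number A)%N).
Proof.
pose P := [pred k : 'I_n.+1 | `[< boundary_family A k >]].
have P0 : (0 < #|P|)%N.
  apply/card_gt0P; exists ord0; apply/asboolP.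
  by exists (fun=> 0); split; case.
split.
  have [k Pk Ek] := eq_bigmax_cond (fun k : 'I_n.+1 => k : nat) P0.
  suff -> : gau_wu_number A = k by exact: (asboolW Pk).
  by rewrite -Ek; apply: eq_bigl => i; rewrite inE.
move=> k bk; have kn : (k < n.+1)%N.
  by have [x [/orthonormal_family_leq]] := bk.
exact: (@leq_bigmax_cond _ (fun k : 'I_n.+1 => `[< boundary_family A k >])
  (fun k : 'I_n.+1 => k : nat) (Ordinal kn) (asboolT bk)).
Qed.

(* Main.v *)
Require Import Defs.
From HB Require Import structures.
From mathcomp Require Import all_boot all_order all_algebra.
From mathcomp Require Import complex.
From mathcomp Require Import all_classical all_reals all_analysis.
From mathcomp Require Import ring lra.

Set Implicit Arguments.
Unset Strict Implicit.
Unset Printing Implicit Defensive.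

Import Order.TTheory GRing.Theory Num.Theory.
Local Open Scope classical_set_scope.
Local Open Scope ring_scope.

(** Write [A] for the arrowhead matrix and [W] for its numerical range.

    Two boundary vectors always exist: [A + adj A], with [adj] the conjugate
    transpose, is Hermitian, so it has orthonormal eigenvectors for its largest
    and its smallest eigenvalue, and at these the real part of the quadratic form
    of [A] is extremal on the sphere ([boundary_family2]).

    For the upper bound let [x] be a unit vector whose value lies on the boundary
    of [W].  Since [W] is convex ([numerical_range_convex], Toeplitz-Hausdorff),
    it has a supporting line there ([support_of_boundary]), that is, there is
    [u != 0] for which [Re (u w)], [w] in [W], is largest at the value of [x].
    Then [M := l - (u A + adj (u A))] is positive semidefinite for a suitable real
    [l], its form vanishes at [x], and hence [M x = 0] ([boundary_eigenvector]).
    This [M] is again an arrowhead, with diagonal entries [l - 2 Re (u a_j)] and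
    off-diagonal entries [- h_j], where [h_j = u b_j + conj (u c_j)]
    ([arrow_pencil]).  If one of these diagonal entries vanished, [a_j] would
    maximise [Re (u a_k)] and lie on the boundary of the hull, so that
    [|b_j| != |c_j|] and [h_j != 0]; but a semidefinite matrix with a zero on its
    diagonal has a zero row there.  So all of them are positive, the last entry
    of [x] is nonzero, and [x_j / x_n = h_j / (l - 2 Re (u a_j))]
    ([boundary_vector]).

    Now let [x] and [y] be two orthogonal such vectors, with directions [u] and
    [v].  Orthogonality says that the sum over [j] of [h_j(u) conj (h_j(v))], with
    positive weights, is [-1].  The imaginary part of the [j]-th term is
    [Im (u conj v) (|b_j|^2 - |c_j|^2)] times its weight, and the hypotheses give
    these differences a common sign, with at least one of them nonzero because
    the hull has an [a_j] on its boundary.  So [u conj v] is real.  It is not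
    positive, for then [v] would be a positive multiple of [u] and the sum would
    be nonnegative.  Hence [u conj v < 0] ([orthogonal_directions]), and three
    complex numbers cannot be pairwise opposite in this way
    ([opposite_directions_triple]). *)

Local Notation rRe := (@complex.Re _).
Local Notation rIm := (@complex.Im _).
Local Notation toC t := (real_complex _ t).
Local Notation sqmod z := (complex.Re z ^+ 2 + complex.Im z ^+ 2).

(** * Boundary points of plane sets *)

Section Plane.
Variable R : realType.
Implicit Types (p q u w z : R[i]) (S : set R[i]).

(** Square neighbourhoods let the topology of the plane be handled through real
    and imaginary parts, by inequalities between reals. *)
Lemma interior_boxP S p :
  (S : set R[i]^o)° p <-> exists2 e : R, 0 < e &
    forall q, `|rRe (q - p)| < e -> `|rIm (q - p)| < e -> S q.
Proof.
split.
  move=> /nbhs_ballP[e /= e0 eS].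
  have /RRe_real eE : e \is Num.real by apply: gtr0_real.
  have e0' : 0 < rRe e by move: e0; rewrite -eE ltcR.
  exists (rRe e / 2); first by rewrite divr_gt0.
  move=> q xe ye; apply: eS; rewrite /ball/= distrC -eE normc_def ltcR.
  rewrite -[ltRHS](gtr0_norm e0') -sqrtr_sqr ltr_sqrt ?exprn_gt0//.
  rewrite -[rRe (q - p) ^+ 2]real_normK ?num_real//.
  rewrite -[rIm (q - p) ^+ 2]real_normK ?num_real//.
  have := normr_ge0 (rRe (q - p)); have := normr_ge0 (rIm (q - p)).
  move: xe ye; move: `|_| `|_| (rRe e) e0' => x y t; nra.
case=> e e0 eS; apply/nbhs_ballP; exists (toC e); first by rewrite /= ltcR.
move=> q; rewrite /ball/= distrC normc_def ltcR => qe; apply: eS.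
  apply: le_lt_trans qe; rewrite -sqrtr_sqr ler_wsqrtr// lerDl sqr_ge0 //.
by apply: le_lt_trans qe; rewrite -sqrtr_sqr ler_wsqrtr// lerDr sqr_ge0 //.
Qed.

Definition support_at S p u := forall w, S w -> rRe (u * w) <= rRe (u * p).

Lemma ReM u w : rRe (u * w) = rRe u * rRe w - rIm u * rIm w.
Proof. by case: u w => [x y] [x' y']; simpc. Qed.

Lemma ImM u w : rIm (u * w) = rRe u * rIm w + rIm u * rRe w.
Proof. by case: u w => [x y] [x' y']; simpc => /=; ring. Qed.

Lemma ReD u w : rRe (u + w) = rRe u + rRe w.
Proof. by case: u w => [x y] [x' y']. Qed.

Lemma ImD u w : rIm (u + w) = rIm u + rIm w.
Proof. by case: u w => [x y] [x' y']. Qed.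

Lemma ReN u : rRe (- u) = - rRe u.
Proof. by case: u. Qed.

Lemma ReZ (t : R) u : rRe (toC t * u) = t * rRe u.
Proof. by case: u => x y; simpc. Qed.

Lemma ImZ (t : R) u : rIm (toC t * u) = t * rIm u.
Proof. by case: u => x y; simpc. Qed.

Lemma ReB u w : rRe (u - w) = rRe u - rRe w.
Proof. by case: u w => [x y] [x' y']. Qed.

Lemma sqmod_gt0 u : u != 0 -> 0 < sqmod u.
Proof.
case: u => x y /=; rewrite eq_complex /= => xy.
rewrite lt_def addr_ge0 ?sqr_ge0// andbT paddr_eq0 ?sqr_ge0//.
by rewrite !expf_eq0.
Qed.

(** From [p] the set cannot be entered in the direction [conj u], along which
    [Re (u _)] increases, so that [p] is not an interior point. *)
Lemma boundary_of_support S p u : S p -> u != 0 -> support_at S p u ->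
  boundary S p.
Proof.
move=> Sp u0 supp; split; first exact: subset_closure.
move=> /interior_boxP[e e0 eS].
have uu := sqmod_gt0 u0.
(* Since [|x| < 1 + x ^ 2], both coordinates of [t conj u] are less than [e]. *)
pose t := e / (1 + rRe u ^+ 2 + rIm u ^+ 2).
have t0 : 0 < t by rewrite divr_gt0// -addrA ltr_wpDr// ltW.
have small (x : R) : x ^+ 2 <= rRe u ^+ 2 + rIm u ^+ 2 -> `|t * x| < e.
  move=> xu; rewrite normrM (gtr0_norm t0) /t mulrAC -mulrA.
  rewrite gtr_pMr// ltr_pdivrMr ?mul1r; last by rewrite -addrA ltr_wpDr// ltW.
  move: xu; rewrite -real_normK ?num_real//; move: `|x| => y; nra.
have : S (p + (t *: (u^* : Rcomplex R))).
  apply: eS; rewrite addrC addKr; case: (u) small => x y /= small.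
    by apply: small; rewrite lerDl sqr_ge0.
  by rewrite mulrN normrN; apply: small; rewrite lerDr sqr_ge0.
move=> /supp; rewrite mulrDr ReD gerDl ReM.
case: (u) uu => x y /= uu; rewrite leNgt => /negP; apply.
by rewrite !mulrN opprK !(mulrCA _ t) -mulrDr mulr_gt0.
Qed.

End Plane.

(** * Supporting lines of convex plane sets *)

Section Separation.
Variable R : realType.
Implicit Types (V : R -> R -> Prop) (x y t : R).

(** Convexity in coordinates: a subset of the plane is given here as a relation
    between the two coordinates of its points. *)
Definition segment_stable V := forall x1 y1 x2 y2 t, 0 <= t -> t <= 1 ->
  V x1 y1 -> V x2 y2 -> V (t * x1 + (1 - t) * x2) (t * y1 + (1 - t) * y2).

(** A triangle with base on the horizontal axis contains the upper half of a box
    around an interior point of its base: a low point [(x, y)] is reached from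
    the apex and a point of the base. *)
Lemma segment_stable_half_box V r x2 y2 : segment_stable V ->
  0 < r -> V (- r) 0 -> V 1 0 -> 0 < y2 -> V x2 y2 ->
  exists2 e : R, 0 < e & forall x y, `|x| < e -> 0 <= y -> y < e -> V x y.
Proof.
move=> cV r0 Vr V1 y20 V2.
have Vaxis z : - r <= z -> z <= 1 -> V z 0.
  move=> rz z1; pose t := (1 - z) / (1 + r).
  have r1 : 0 < 1 + r by rewrite addr_gt0.
  have := cV _ _ _ _ t _ _ Vr V1.
  rewrite !mulr0 addr0 (_ : t * - r + (1 - t) * 1 = z); last first.
    by rewrite /t; field; rewrite gt_eqF.
  apply; first by rewrite divr_ge0 ?subr_ge0// ltW.
  by rewrite ler_pdivrMr//; lra.
(* [mu] is the distance from the origin to the nearer end of the base. *)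
pose mu := Num.min r 1.
have mu0 : 0 < mu by rewrite lt_min r0 ltr01.
have mur : mu <= r by rewrite ge_min lexx.
have mu1 : mu <= 1 by rewrite ge_min lexx orbT.
have D0 : 0 < y2 + `|x2| + mu by rewrite addr_gt0// ltr_wpDr.
(* With [t = y / y2] the point of the base is [(x - t x2) / (1 - t)]; this is the
   bound which keeps it within [mu] of the origin. *)
exists (mu * y2 / (y2 + `|x2| + mu)); first by rewrite divr_gt0// mulr_gt0.
move=> x y; rewrite !ltr_pdivlMr// => xe y0 ye.
pose t := y / y2.
have yE : y = t * y2 by rewrite /t divfK ?gt_eqF.
have t0 : 0 <= t by rewrite divr_ge0// ltW.
have te : t * (y2 + `|x2| + mu) < mu by move: ye; rewrite yE; nra.
have x20 := normr_ge0 x2.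
have t1 : t < 1 by nra.
have xx : `|x| * y2 + t * (`|x2| + mu) * y2 <= mu * y2.
  have := normr_ge0 x; move: xe ye; rewrite yE; move: `|x| `|x2| x20 => X X2; nra.
have bnd : `|x - t * x2| <= (1 - t) * mu.
  apply: le_trans (ler_normB _ _) _; rewrite normrM (ger0_norm t0).
  by rewrite -(ler_pM2r y20); move: xx; lra.
have s1 : 0 < 1 - t by rewrite subr_gt0.
have := Vaxis ((x - t * x2) / (1 - t)).
rewrite ler_pdivlMr// ler_pdivrMr//.
move: bnd; rewrite ler_norml => /andP[b1 b2] Vz.
have {}Vz := Vz ltac:(nra) ltac:(nra).
have := cV _ _ _ _ t t0 (ltW t1) V2 Vz.
by rewrite mulr0 addr0 -yE mulrCA mulfV ?gt_eqF// mulr1 addrC subrK.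
Qed.

(** The alternative at the origin between a supporting line and an interior
    point.  Assume that there are points on both sides of the horizontal axis.
    If the set meets the negative half of that axis, the origin is interior to a
    quadrilateral of points of the set.  Otherwise every segment between an upper
    and a lower point crosses the axis on the nonnegative side, which bounds the
    ratios [x / y] of the upper points from below by those of the lower ones; with
    [s] the infimum of the former, [x = s y] is a supporting line. *)
Lemma segment_stable_support V : segment_stable V -> V 1 0 ->
  (exists a b, (a, b) != (0, 0) /\ forall x y, V x y -> a * x + b * y <= 0) \/
  (exists2 e : R, 0 < e & forall x y, `|x| < e -> `|y| < e -> V x y).
Proof.
move=> cV V1.
have [up|] := pselect (forall x y, V x y -> y <= 0).
  left; exists 0, 1; split; first by rewrite xpair_eqE oner_eq0 andbF.
  by move=> x y /up; rewrite mul0r mul1r add0r.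
move=> /existsNP[x2 /existsNP[y2 /not_implyP[V2 /negP]]]; rewrite -ltNge => y20.
have [dn|] := pselect (forall x y, V x y -> 0 <= y).
  left; exists 0, (-1); split; first by rewrite xpair_eqE oppr_eq0 oner_eq0 andbF.
  by move=> x y /dn; rewrite mul0r add0r mulN1r oppr_le0.
move=> /existsNP[x3 /existsNP[y3 /not_implyP[V3 /negP]]]; rewrite -ltNge => y30.
have [[r [r0 Vr]]|noneg] := pselect (exists r, 0 < r /\ V (- r) 0).
  right; have [e e0 eV] := segment_stable_half_box cV r0 Vr V1 y20 V2.
  pose V' x y := V x (- y).
  have cV' : segment_stable V'.
    move=> a b c d t t0 t1 Va Vb; rewrite /V' opprD -!mulrN.
    exact: cV.
  have [e' e'0 e'V] := @segment_stable_half_box V' r x3 (- y3) cV' r0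
    ltac:(by rewrite /V' oppr0) ltac:(by rewrite /V' oppr0)
    ltac:(by rewrite oppr_gt0) ltac:(by rewrite /V' opprK).
  exists (Num.min e e'); first by rewrite lt_min e0.
  move=> x y; rewrite !lt_min => /andP[xe xe'] /andP[ye ye'].
  have [y0|y0] := leP 0 y; first by apply: eV => //; rewrite -(ger0_norm y0).
  rewrite -(opprK y); apply: e'V; rewrite ?oppr_ge0 ?ltW//.
  by rewrite -(ltr0_norm y0).
left.
have cross x y x' y' : V x y -> 0 < y -> V x' y' -> y' < 0 -> x' / y' <= x / y.
  move=> Vp y0 Vq y'0; rewrite leNgt; apply/negP => lt.
  have d0 : 0 < y - y' by lra.
  apply: noneg; exists (- ((x * - y' + x' * y) / (y - y'))); split.
    rewrite -mulNr divr_gt0//.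
    by move: lt; rewrite ltr_pdivrMr// mulrAC ltr_ndivlMr//; lra.
  pose t := - y' / (y - y').
  have := cV _ _ _ _ t _ _ Vp Vq; rewrite opprK.
  rewrite (_ : t * y + _ = 0); last by rewrite /t; field; rewrite gt_eqF.
  rewrite (_ : t * x + _ = (x * - y' + x' * y) / (y - y')); last first.
    by rewrite /t; field; rewrite gt_eqF.
  apply; first by rewrite divr_ge0//; lra.
  by rewrite ler_pdivrMr//; lra.
pose S : set R := [set z | exists x y, [/\ V x y, 0 < y & z = x / y]].
have lbS : lbound S (x3 / y3).
  by move=> _ [x [y [Vp y0 ->]]]; exact: cross.
have S0 : S !=set0 by exists (x2 / y2), x2, y2.
exists (-1), (inf S); split; first by rewrite xpair_eqE oppr_eq0 oner_eq0.
move=> x y Vp; rewrite mulN1r addrC subr_le0.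
have [y0|y0|y0] := ltgtP y 0.
- have : x / y <= inf S.
    by apply: lb_le_inf => // _ [x' [y' [Vp' y'0 ->]]]; exact: cross.
  by rewrite ler_ndivrMr.
- have : inf S <= x / y.
    by apply: ge_inf; [exists (x3 / y3) | exists x, y].
  by rewrite ler_pdivlMr.
rewrite y0 mulr0 leNgt; apply/negP => x0; apply: noneg.
by rewrite y0 in Vp; exists (- x); rewrite oppr_gt0 opprK.
Qed.

End Separation.

Section PlaneSupport.
Variable R : realType.
Implicit Types (p q u w z : R[i]) (S : set R[i]).

Lemma convex_setP S : @convex_set R (Rcomplex R) S <->
  forall p q t, 0 <= t -> t <= 1 -> S p -> S q ->
    S (toC t * p + toC (1 - t) * q).
Proof.
have scE (t : R) (z : Rcomplex R) : t *: z = toC t * z.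
  by case: z => x y; simpc.
split => [cS p q t t0 t1 Sp Sq | cS p q t /set_mem Sp /set_mem Sq].
  have t01 : (0 <= t <= 1) by rewrite t0.
  have := cS p q (Itv01 t0 t1); rewrite !inE => /(_ Sp Sq).
  by rewrite /conv/= !scE.
rewrite inE /conv/= !scE; apply: cS => //.
Qed.

(** The affine map which takes [0] to [p] and [1] to another point of the set
    reduces this to [segment_stable_support]. *)
Lemma support_of_boundary S p : @convex_set R (Rcomplex R) S -> S p ->
  boundary S p -> exists2 u, u != 0 & support_at S p u.
Proof.
move=> /convex_setP cS Sp [_ nint].
have [trivS|] := pselect (forall w, S w -> w = p).
  by exists 1; [exact: oner_neq0 | move=> w /trivS ->].
move=> /existsNP[w1 /not_implyP[Sw1 /eqP w1p]].
pose d := w1 - p; have d0 : d != 0 by rewrite subr_eq0.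
pose V (x y : R) := S (p + d * Complex x y).
have cV : segment_stable V.
  move=> x1 y1 x2 y2 t t0 t1 V1 V2; rewrite /V.
  have -> : Complex (t * x1 + (1 - t) * x2) (t * y1 + (1 - t) * y2) =
     toC t * Complex x1 y1 + (1 - toC t) * Complex x2 y2.
    by simpc.
  have := cS _ _ t t0 t1 V1 V2; rewrite rmorphB rmorph1.
  by congr S; ring.
have V1 : V 1 0.
  by rewrite /V (_ : Complex 1 0 = 1)// mulr1 /d addrC subrK.
have VE w : V (rRe ((w - p) / d)) (rIm ((w - p) / d)) = S w.
  rewrite /V (_ : Complex _ _ = (w - p) / d); last by case: (_ / _).
  by rewrite mulrC divfK// addrC subrK.
have [[a [b [ab0 sup]]]|[e e0 eV]] := segment_stable_support cV V1.
  exists (Complex a (- b) / d).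
    rewrite mulf_neq0 ?invr_eq0//; apply: contra ab0.
    by rewrite eq_complex /= oppr_eq0 xpair_eqE.
  move=> w; rewrite -VE => /sup supw; rewrite -subr_le0 -ReB.
  rewrite (_ : _ - _ = Complex a (- b) * ((w - p) / d)); last by ring.
  by rewrite ReM /= mulNr opprK.
exfalso; apply: nint; apply/interior_boxP.
pose m := 1 + `|rRe d^-1| + `|rIm d^-1|.
have m0 : 0 < m by rewrite !ltr_wpDr.
exists (e / m); first exact: divr_gt0.
move=> q; rewrite !ltr_pdivlMr// => xe ye.
rewrite -VE; apply: eV; rewrite ?ReM ?ImM.
  apply: le_lt_trans (ler_normB _ _) _; rewrite !normrM.
  move: xe ye; rewrite /m.
  have := normr_ge0 (rRe (q - p)); have := normr_ge0 (rIm (q - p)).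
  have := normr_ge0 (rRe d^-1); have := normr_ge0 (rIm d^-1).
  move: `|_| `|_| `|_| `|_| => A B X Y; nra.
apply: le_lt_trans (ler_normD _ _) _; rewrite !normrM.
move: xe ye; rewrite /m.
have := normr_ge0 (rRe (q - p)); have := normr_ge0 (rIm (q - p)).
have := normr_ge0 (rRe d^-1); have := normr_ge0 (rIm d^-1).
move: `|_| `|_| `|_| `|_| => A B X Y; nra.
Qed.

End PlaneSupport.

(** * Inner product and numerical range *)

Section Inner.
Local Open Scope sesquilinear_scope.
Variables (R : realType) (n : nat).
Implicit Types (x y z : 'cV[R[i]]_n) (A : 'M[R[i]]_n) (k : R[i]).

Lemma innerDl x y z : inner (x + y) z = inner x z + inner y z.
Proof.
by rewrite !innerE -big_split; apply: eq_bigr => i _; rewrite mxE mulrDl.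
Qed.

Lemma innerZl k x z : inner (k *: x) z = k * inner x z.
Proof.
by rewrite !innerE mulr_sumr; apply: eq_bigr => i _; rewrite mxE mulrA.
Qed.

Lemma inner_conj x y : inner y x = (inner x y)^*.
Proof.
rewrite !innerE rmorph_sum; apply: eq_bigr => i _.
by rewrite rmorphM /= conjCK mulrC.
Qed.

Lemma innerDr x y z : inner x (y + z) = inner x y + inner x z.
Proof.
by rewrite (inner_conj _ x) (inner_conj y x) (inner_conj z x) innerDl rmorphD.
Qed.

Lemma innerZr k x y : inner x (k *: y) = k^* * inner x y.
Proof. by rewrite (inner_conj _ x) (inner_conj y x) innerZl rmorphM. Qed.

Lemma inner_ge0 x : 0 <= inner x x.
Proof. by rewrite innerE sumr_ge0// => i _; rewrite mul_conjC_ge0. Qed.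

Lemma inner_eq0 x : inner x x = 0 -> x = 0.
Proof.
rewrite innerE => /eqP; rewrite psumr_eq0; last first.
  by move=> i _; rewrite mul_conjC_ge0.
move=> /allP x0; apply/matrixP => i j; rewrite mxE (ord1 j).
by have := x0 i (mem_index_enum _); rewrite mul_conjC_eq0 => /eqP.
Qed.

Lemma inner0l x : inner 0 x = 0.
Proof. by rewrite -[0](scale0r 0) innerZl mul0r. Qed.

Lemma inner_gt0 x : x != 0 -> 0 < inner x x.
Proof.
by move=> x0; rewrite lt_def inner_ge0 andbT; apply: contraNneq x0 => /inner_eq0 ->.
Qed.

Lemma inner_adjoint A x y :
  inner (A *m x) y = inner x (A^t* *m y).
Proof.
rewrite !innerE; under eq_bigr do rewrite mxE mulr_suml.
rewrite exchange_big; apply: eq_bigr => j _ /=.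
rewrite mxE rmorph_sum mulr_sumr; apply: eq_bigr => i _.
by rewrite !mxE rmorphM /= conjCK mulrCA mulrA.
Qed.

Lemma qform_comb A k l x y : qform A (k *: x + l *: y) =
  k * k^* * qform A x + l * l^* * qform A y +
  (k * l^* * inner (A *m x) y + l * k^* * inner (A *m y) x).
Proof.
rewrite /qform mulmxDr -!scalemxAr !innerDl !innerDr !innerZl !innerZr.
move: (k^*) (l^*) (inner (A *m x) x) (inner (A *m x) y) => k' l' a b.
by move: (inner (A *m y) x) (inner (A *m y) y) => c d; ring.
Qed.

Lemma qformZ A k x : qform A (k *: x) = k * k^* * qform A x.
Proof. by rewrite /qform -scalemxAr innerZl innerZr mulrA. Qed.

Lemma qform1 x : qform 1%:M x = inner x x.
Proof. by rewrite /qform mul1mx. Qed.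

Lemma conj_toC (t : R) : (toC t)^* = toC t.
Proof. by rewrite conj_Creal// complex_real. Qed.

(** Rayleigh quotients: nonzero vectors need not be normalised. *)
Lemma numerical_range_quotient A z : z != 0 ->
  numerical_range A (qform A z / inner z z).
Proof.
move=> /inner_gt0 z0; exists ((sqrtC (inner z z))^-1 *: z) => /=.
  rewrite -qform1 qformZ qform1 geC0_conj ?invr_ge0 ?sqrtC_ge0 ?ltW//.
  by rewrite -invfM -expr2 sqrtCK mulVf ?gt_eqF.
rewrite qformZ geC0_conj ?invr_ge0 ?sqrtC_ge0 ?ltW//.
by rewrite -invfM -expr2 sqrtCK mulrC.
Qed.

Lemma qformDZ A B k x : qform (A + k *: B) x = qform A x + k * qform B x.
Proof. by rewrite /qform mulmxDl -scalemxAl innerDl innerZl. Qed.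

Lemma qformZm A k x : qform (k *: A) x = k * qform A x.
Proof. by rewrite /qform -scalemxAl innerZl. Qed.

(** The left-hand side minus the right-hand side is [- t] at [s = 0] and [1 - t]
    at [s = 1]. *)
Lemma quadratic_root_unit (kap nu t : R) : 0 <= t -> t <= 1 ->
  exists2 s, 0 <= s <= 1 &
    s ^+ 2 + s * (1 - s) * kap =
    t * (s ^+ 2 + (1 - s) ^+ 2 + s * (1 - s) * nu).
Proof.
move=> t0 t1.
pose P : {poly R} := 'X ^+ 2 + 'X * (1 - 'X) * kap%:P -
  t%:P * ('X ^+ 2 + (1 - 'X) ^+ 2 + 'X * (1 - 'X) * nu%:P).
have PE s : P.[s] = s ^+ 2 + s * (1 - s) * kap -
    t * (s ^+ 2 + (1 - s) ^+ 2 + s * (1 - s) * nu).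
  by rewrite /P !hornerE.
have [//||s s01 /rootP] := @Num.poly_ivt R P 0 1.
  by rewrite !PE; apply/andP; split; lra.
by rewrite PE => /subr0_eq; exists s.
Qed.

(** The imaginary part of [w k + conj w l] is that of [w (k - conj l)], which the
    phase opposite to that of [k - conj l] makes zero. *)
Lemma rephase (k l : R[i]) :
  exists2 w : R[i], w * w^* = 1 & w * k + w^* * l \is Num.real.
Proof.
have [kl|kl] := eqVneq (k - l^*) 0.
  exists 1; first by rewrite conjC1 mulr1.
  rewrite conjC1 !mul1r (subr0_eq kl) CrealE rmorphD /= conjCK addrC eqxx //.
have [d [d0 ->]] : exists d, d != 0 /\ k = d + l^*.
  by exists (k - l^*); rewrite subrK.
have nd : `|d| != 0 by rewrite normr_eq0.
exists (d^* / `|d|).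
  rewrite rmorphM /= conjCK fmorphV /= (conj_Creal (normr_real d)).
  by rewrite mulrACA [d^* * d]mulrC -normCK -invfM -expr2 mulfV ?expf_neq0.
rewrite rmorphM /= conjCK fmorphV /= (conj_Creal (normr_real d)).
rewrite !(mulrAC _ _^-1) -mulrDl realM ?rpredV ?normr_real//.
rewrite CrealE !(rmorphD, rmorphM) /= !conjCK; apply/eqP.
by move: (d^*) (l^*) => d' l'; ring.
Qed.

(** Toeplitz-Hausdorff theorem.  An affine change of [A] gives the form the value
    [1] at [x] and [0] at [y].  After a change of the phase of [x] it is real on
    the real span of [x] and [y], so that all intermediate values are attained
    by the vectors [s x + (1 - s) y], [0 <= s <= 1]. *)
Theorem numerical_range_convex A :
  @convex_set R (Rcomplex R) (numerical_range A).
Proof.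
apply/convex_setP => _ _ t t0 t1 [x /= x1 <-] [y /= y1 <-].
move pE : (qform A x) => p; move qE : (qform A y) => q.
have [pq|pq] := eqVneq p q.
  rewrite pq -mulrDl -rmorphD /= addrC subrK rmorph1 mul1r.
  by exists y; rewrite ?qE.
have d0 : p - q != 0 by rewrite subr_eq0.
pose B := (p - q)^-1 *: (A + (- q) *: 1%:M).
have Bx : qform B x = 1 by rewrite qformZm qformDZ qform1 pE x1 mulr1 mulVf.
have By : qform B y = 0 by rewrite qformZm qformDZ qform1 qE y1 mulr1 addrN mulr0.
have [w w1 /complex_realP[kap kapE]] :=
  rephase (inner (B *m x) y) (inner (B *m y) x).
have /complex_realP[nu nuE] : w * inner x y + w^* * inner y x \is Num.real.
  by rewrite (inner_conj x y) CrealE rmorphD !rmorphM /= !conjCK addrC.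
have [s /andP[s0 s1] sE] := quadratic_root_unit kap nu t0 t1.
pose z := (toC s * w) *: x + toC (1 - s) *: y.
have phase M r : w * inner (M *m x) y + w^* * inner (M *m y) x = toC r ->
    qform M z = toC s ^+ 2 * qform M x + toC (1 - s) ^+ 2 * qform M y
      + toC (s * (1 - s)) * toC r.
  move=> <-; rewrite qform_comb [(toC s * w)^*]rmorphM /= !conj_toC.
  rewrite [toC (s * _)]rmorphM /=.
  have -> : toC s * w * (toC s * w^*) = toC s ^+ 2.
    by rewrite mulrACA w1 mulr1 expr2.
  move: (toC s) (toC (1 - s)) (w^*) => a b w'.
  move: (qform M x) (qform M y) (inner _ _) (inner _ _) => c d e f.
  ring.
have Nz : inner z z = toC (s ^+ 2 + (1 - s) ^+ 2 + s * (1 - s) * nu).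
  rewrite -(qform1 z) (phase _ nu) ?mul1mx// !qform1 x1 y1 !mulr1.
  rewrite [RHS]rmorphD [X in _ = X + _]rmorphD [X in _ = _ + X]rmorphM.
  by rewrite 2!rmorphXn.
have Bz : qform B z = toC t * inner z z.
  rewrite (phase _ _ kapE) Bx By Nz mulr0 addr0 mulr1 -[RHS]rmorphM -sE.
  by rewrite rmorphD rmorphXn [X in _ = _ + X]rmorphM.
have z0 : z != 0.
  apply/eqP => z0.
  have : qform B (toC s * w *: x) = qform B (- (toC (1 - s) *: y)).
    by congr qform; apply/eqP; rewrite -addr_eq0; apply/eqP.
  rewrite -scaleNr !qformZ By Bx mulr0 mulr1 => /eqP.
  rewrite mul_conjC_eq0 mulf_eq0 => /orP[/eqP s00|/eqP w0]; last first.
    by move: w1; rewrite w0 mul0r => /esym/eqP; rewrite oner_eq0.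
  move: z0; rewrite /z s00 mul0r scale0r add0r (complexI s00) subr0 scale1r.
  move=> y0; move: y1; rewrite y0 inner0l => /esym/eqP.
  by rewrite oner_eq0.
have := numerical_range_quotient A z0.
congr (numerical_range A _).
have Nz0 : inner z z != 0 by rewrite gt_eqF// inner_gt0.
have -> : qform A z = (p - q) * qform B z + q * inner z z.
  by rewrite qformZm qformDZ qform1 mulVKf// mulNr subrK.
rewrite Bz rmorphB rmorph1; field.
exact: Nz0.
Qed.

End Inner.

(** * Hermitian forms and extremal vectors *)

Section Hermitian.
Local Open Scope sesquilinear_scope.
Variables (R : realType) (n : nat).
Implicit Types (x y z : 'cV[R[i]]_n) (A M : 'M[R[i]]_n).

(** A nonnegative function of [t] that is zero at [t = 0] cannot start with
    negative slope. *)
Lemma quadratic_slope_eq0 (F : numFieldType) (Y K : F) : 0 <= Y -> 0 <= K ->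
  (forall t, 0 < t -> 0 <= t * t * K - (t * Y + t * Y)) -> Y = 0.
Proof.
move=> Y0 K0 ge0; apply/eqP/negP => /negP Y1.
have {}Y0 : 0 < Y by rewrite lt_def Y1.
have K1 : 0 < K + 1 by rewrite ltr_wpDl.
pose t := Y / (K + 1).
have t0 : 0 < t by rewrite divr_gt0.
have := ge0 t t0; rewrite -mulrA -mulrDr -mulrBr pmulr_rge0// subr_ge0.
apply/negP; rewrite lt_geF//.
have : t * K <= Y by rewrite /t mulrAC ler_pdivrMr// mulrDr mulr1 lerDl ltW.
by move=> /le_lt_trans; apply; rewrite ltrDl.
Qed.

(** Moving from [x] in the direction [- M x] would make the form negative to
    first order unless [M x = 0]. *)
Lemma psd_kernel M x : M^t* = M -> (forall z, 0 <= qform M z) ->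
  qform M x = 0 -> M *m x = 0.
Proof.
move=> Mh Mge Mx0; apply: inner_eq0.
move yE : (M *m x) => y.
apply: (quadratic_slope_eq0 (inner_ge0 y) (Mge y)) => t t0.
have MyE : inner (M *m y) x = inner y y by rewrite inner_adjoint Mh yE.
have tr : t^* = t by rewrite (conj_Creal (gtr0_real t0)).
have := Mge (1 *: x + (- t) *: y).
rewrite qform_comb Mx0 MyE yE rmorphN /= tr conjC1.
by rewrite mulr0 add0r mul1r mulr1 mulrNN !mulNr -opprD.
Qed.

Lemma qform_hermitian_part A z :
  qform (A + A^t*) z = toC (2 * rRe (qform A z)).
Proof.
rewrite /qform mulmxDl innerDl [X in _ + X]inner_adjoint trmxCK.
rewrite [X in _ + X]inner_conj; case: (inner _ _) => a b.
by simpc; rewrite /= mulr_natl.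
Qed.

Lemma unitary_col_inner (P : 'M[R[i]]_n) x y : P \is unitarymx ->
  inner (P^t* *m x) (P^t* *m y) = inner x y.
Proof.
by move=> /unitarymxP PP; rewrite inner_adjoint trmxCK mulmxA PP mul1mx.
Qed.

Lemma inner_delta i j :
  inner (delta_mx i 0 : 'cV[R[i]]_n) (delta_mx j 0) = (i == j)%:R.
Proof.
rewrite innerE (bigD1 i)//= !mxE !eqxx mul1r andbT conjC_nat big1 ?addr0//.
by move=> k ki; rewrite !mxE (negbTE ki) mul0r.
Qed.

Lemma boundary_of_max A x u r : u != 0 -> inner x x = 1 ->
  rRe (u * qform A x) = r ->
  (forall z, inner z z = 1 -> rRe (u * qform A z) <= r) ->
  boundary (numerical_range A) (qform A x).
Proof.
move=> u0 x1 <- max; apply: (boundary_of_support _ u0); first by exists x.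
by move=> _ [z z1 <-]; exact: max.
Qed.

(** The form of [A + adj A], twice the real part of that of [A], is a convex
    combination of its eigenvalues on the unit sphere, so that its extrema are
    attained at eigenvectors. *)
Theorem boundary_family2 A : (1 < n)%N -> boundary_family A 2.
Proof.
move=> n1; pose H := A + A^t*.
have Hh : H \is hermsymmx.
  apply/is_hermitianmxP; rewrite expr0 scale1r /H linearD /= map_mxD trmxCK.
  by rewrite addrC.
have /orthomx_spectralP HE := hermitian_normalmx Hh.
have Pu := spectral_unitarymx H; have dr := hermitian_spectral_diag_real Hh.
move: (spectralmx H) (spectral_diag H) Pu dr HE => P d Pu dr HE.
rewrite invmx_unitary// in HE.
pose r k := rRe (d 0 k).
have rE k : d 0 k = toC (r k).
  by rewrite RRe_real//; move/mxOverP: dr; apply.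
pose e k : 'cV[R[i]]_n := P^t* *m delta_mx k 0.
have eo i j : inner (e i) (e j) = (i == j)%:R.
  by rewrite unitary_col_inner// inner_delta.
have Hq y : qform H (P^t* *m y) = \sum_k d 0 k * (y k 0 * (y k 0)^*).
  rewrite /qform HE -!mulmxA (mulmxA P) (unitarymxP Pu) mul1mx.
  rewrite unitary_col_inner// innerE; apply: eq_bigr => k _.
  by rewrite mul_diag_mx mxE mulrA.
have surj z : z = P^t* *m (P *m z).
  by rewrite mulmxA -invmx_unitary// mulVmx ?mul1mx// unitarymx_unit.
have He k : rRe (qform A (e k)) = r k / 2.
  suff : qform H (e k) = toC (r k).
    by rewrite qform_hermitian_part => /complexI <-; field.
  rewrite Hq (bigD1 k)//= big1 ?addr0.
    by rewrite mxE !eqxx conjC1 !mulr1 rE.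
  by move=> l lk; rewrite mxE (negbTE lk) mul0r mulr0.
clearbody e.
have bnd z : inner z z = 1 -> exists w : 'I_n -> R,
    [/\ forall k, 0 <= w k, \sum_k w k = 1 &
        rRe (qform A z) = (\sum_k r k * w k) / 2].
  rewrite (surj z); move: (P *m z) => y; rewrite unitary_col_inner// => y1.
  exists (fun k => rRe (`|y k 0| ^+ 2)).
  have wE k : toC (rRe (`|y k 0| ^+ 2)) = y k 0 * (y k 0)^*.
    by rewrite RRe_real -?normCK// ger0_real// exprn_ge0.
  split.
  - by move=> k; rewrite -lecR wE mul_conjC_ge0.
  - apply: complexI; rewrite rmorph_sum rmorph1 -y1 innerE.
    by apply: eq_bigr => k _; exact: wE.
  have : qform H (P^t* *m y) = toC (\sum_k r k * rRe (`|y k 0| ^+ 2)).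
    rewrite Hq rmorph_sum; apply: eq_bigr => k _.
    by rewrite rmorphM rE /= wE.
  by rewrite qform_hermitian_part => /complexI <-; field.
pose i0 := Ordinal (ltnW n1).
pose i := [arg max_(i > i0) r i]%O.
have imax k : r k <= r i.
  by rewrite /i; case: arg_maxP => //= j _ /(_ k); apply.
have [j0 j0i] : exists j0, j0 != i.
  have [->|h] := eqVneq i i0; last by exists i0; rewrite eq_sym.
  by exists (Ordinal n1).
(* The restriction to [j != i] matters when all eigenvalues are equal. *)
pose j := [arg min_(j < j0 | j != i) r j]%O.
have [ji jmin] : j != i /\ forall k, r j <= r k.
  rewrite /j; case: arg_minP => //= j' j'i min; split=> // k.
  by have [->|/min//] := eqVneq k i; exact: imax.
exists (fun k : 'I_2 => if val k == 0%N then e i else e j); split.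
  move=> [[|[|//]] h] [[|[|//]] h'] /=; rewrite eo ?eqxx//.
    by rewrite eq_sym (negbTE ji).
  by rewrite (negbTE ji).
move=> [[|[|//]] h] /=.
  apply: (@boundary_of_max _ _ 1 (r i / 2)); [exact: oner_neq0|by rewrite eo eqxx
    |by rewrite mul1r He|move=> z /bnd[w [w0 w1 zE]]; rewrite mul1r zE].
  rewrite ler_pM2r ?invr_gt0// -[r i]mulr1 -w1 mulr_sumr ler_sum// => k _.
  by rewrite ler_wpM2r.
apply: (@boundary_of_max _ _ (-1) (- (r j / 2))); [by rewrite oppr_eq0 oner_neq0
  |by rewrite eo eqxx|by rewrite mulN1r ReN He
  |move=> z /bnd[w [w0 w1 zE]]; rewrite mulN1r ReN zE lerN2].
rewrite ler_pM2r ?invr_gt0// -[r j]mulr1 -w1 mulr_sumr ler_sum// => k _.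
by rewrite ler_wpM2r.
Qed.

End Hermitian.

(** * Arrowhead matrices *)

Section Arrowhead.
Local Open Scope sesquilinear_scope.
Variables (R : realType) (m : nat).
Implicit Types (a b c : 'I_m -> R[i]) (an u v : R[i]) (x y : 'cV[R[i]]_(m + 1)).

(** The half plane [Re (u w) <= Re (u a_j)] is convex and contains all [a_k],
    hence their hull. *)
Lemma hull_boundary_of_max a j u : u != 0 ->
  (forall k, rRe (u * a k) <= rRe (u * a j)) -> hull_boundary_indices a j.
Proof.
move=> u0 amax; apply: (boundary_of_support _ u0).
  by apply: sub_gen_smallest; exists j.
apply: smallest_sub.
  apply/convex_setP => p q t t0 t1 /= pj qj.
  rewrite mulrDr ReD !(mulrCA u) !ReZ.
  move: (rRe (u * p)) (rRe (u * q)) (rRe (u * a j)) pj qj => P Q J; nra.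
by move=> _ [k _ <-]; exact: amax.
Qed.

Lemma inner_arrow x y : inner x y =
  \sum_j x (lshift 1 j) 0 * (y (lshift 1 j) 0)^*
    + x (rshift m 0) 0 * (y (rshift m 0) 0)^*.
Proof. by rewrite innerE big_split_ord /= big_ord1. Qed.

Lemma arrow_mul_body a b c an x j : (arrowhead a b c an *m x) (lshift 1 j) 0 =
  a j * x (lshift 1 j) 0 + b j * x (rshift m 0) 0.
Proof.
rewrite mxE big_split_ord /= big_ord1 block_mxEur mxE (bigD1 j)//=.
rewrite block_mxEul !mxE eqxx mulr1n big1 ?addr0// => k kj.
by rewrite block_mxEul !mxE eq_sym (negbTE kj) mulr0n mul0r.
Qed.

Lemma arrow_mul_tip a b c an x : (arrowhead a b c an *m x) (rshift m 0) 0 =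
  \sum_j c j * x (lshift 1 j) 0 + an * x (rshift m 0) 0.
Proof.
rewrite mxE big_split_ord /= big_ord1 block_mxEdr mxE eqxx mulr1n.
by congr (_ + _); apply: eq_bigr => k _; rewrite block_mxEdl mxE.
Qed.

(** The off-diagonal entries of the Hermitian matrix [u A + adj (u A)]. *)
Definition coupling u (bj cj : R[i]) : R[i] := u * bj + (u * cj)^*.

Lemma arrow_pencil a b c an u l :
  (toC l)%:M - (u *: arrowhead a b c an + (u *: arrowhead a b c an)^t*) =
  arrowhead (fun j => toC (l - 2 * rRe (u * a j)))
    (fun j => - coupling u (b j) (c j)) (fun j => - (coupling u (b j) (c j))^*)
    (toC (l - 2 * rRe (u * an))).
Proof.
have addJ (z : R[i]) : z + z^* = toC (2 * rRe z).
  by case: z => x y; simpc; rewrite /= mulr_natl.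
rewrite scalar_mx_block /arrowhead scale_block_mx tr_block_mx map_block_mx.
rewrite add_block_mx opp_block_mx add_block_mx; congr block_mx.
- apply/matrixP => i j; rewrite !mxE [i == j]eq_sym.
  case: eqVneq => [->|_]; last by rewrite !mulr0n mulr0 conjC0 addr0 subr0.
  by rewrite !mulr1n rmorphB /= -addJ.
- by apply/matrixP => i j; rewrite !mxE add0r /coupling.
- apply/matrixP => i j; rewrite !mxE add0r /coupling rmorphD /= conjCK.
  by rewrite addrC.
- by apply/matrixP => i j; rewrite !mxE !ord1 eqxx !mulr1n rmorphB /= -addJ.
Qed.

Lemma sqmodE (z : R[i]) : toC (sqmod z) = `|z| ^+ 2.
Proof. exact: add_Re2_Im2. Qed.

Lemma coupling_neq0 u (bj cj : R[i]) :
  u != 0 -> `|bj| != `|cj| -> coupling u bj cj != 0.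
Proof.
move=> u0; apply: contraNneq => /eqP; rewrite addr_eq0 => /eqP E.
have := congr1 Num.norm E; rewrite normrN norm_conjC !normrM.
by move=> /mulfI-> //; rewrite normr_eq0.
Qed.

(** In the expansion the two terms that mix [bj] and [cj] are conjugate to each
    other, and the terms in [|bj|^2] and [|cj|^2] have the conjugate coefficients
    [u conj v] and [v conj u]. *)
Lemma coupling_cross_Im u v (bj cj : R[i]) :
  rIm (coupling u bj cj * (coupling v bj cj)^*) =
  rIm (u * v^*) * (sqmod bj - sqmod cj).
Proof.
rewrite /coupling; case: u v bj cj => [u1 u2] [v1 v2] [b1 b2] [c1 c2].
by simpc => /=; ring.
Qed.

(** A supporting line of the numerical range at the value of [x] turns [x] into
    an eigenvector for the largest eigenvalue [l] of [u A + adj (u A)]. *)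
Lemma boundary_eigenvector n (A : 'M[R[i]]_n) (x : 'cV[R[i]]_n) :
  inner x x = 1 -> boundary (numerical_range A) (qform A x) ->
  exists u l, let M := (toC l)%:M - (u *: A + (u *: A)^t*) in
    [/\ u != 0, M^t* = M, forall z, 0 <= qform M z & M *m x = 0].
Proof.
move=> x1 bx; have Wx : numerical_range A (qform A x) by exists x.
have [u u0 sup] := support_of_boundary (@numerical_range_convex _ _ A) Wx bx.
have {}sup w : numerical_range A w -> rRe (u * w) <= rRe (u * qform A x).
  exact: sup.
move pE : (rRe (u * qform A x)) sup => p sup.
exists u, (2 * p); move=> M.
have Hq z : qform (u *: A + (u *: A)^t*) z = toC (2 * rRe (u * qform A z)).
  by rewrite qform_hermitian_part qformZm.
have Mq z : qform M z = toC (2 * p) * inner z z - toC (2 * rRe (u * qform A z)).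
  rewrite /M -scaleN1r qformDZ Hq mulN1r.
  by congr (_ - _); rewrite -scalemx1 qformZm qform1.
have Mh : M^t* = M.
  rewrite /M linearB linearD /= map_mxB map_mxD trmxCK tr_scalar_mx.
  by rewrite map_scalar_mx /= conj_toC [X in _ - X]addrC.
have Mge z : 0 <= qform M z.
  have [->|z0] := eqVneq z 0; first by rewrite /qform mulmx0 inner0l.
  have Nz := inner_gt0 z0.
  have /complex_realP[N NE] : inner z z \is Num.real by rewrite gtr0_real.
  have := sup _ (numerical_range_quotient A z0).
  rewrite Mq NE; rewrite NE ltcR in Nz.
  have -> : rRe (u * (qform A z / toC N)) = N^-1 * rRe (u * qform A z).
    by move: (qform A z) => q; rewrite mulrA mulrC -fmorphV ReZ.
  move: (rRe (u * qform A z)) => q.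
  rewrite ler_pdivrMl// => le; rewrite -rmorphM -rmorphB /= ler0c subr_ge0.
  by rewrite -mulrA ler_pM2l// mulrC.
exists => //; apply: psd_kernel => //.
by rewrite Mq pE x1 mulr1 addrN.
Qed.

(** Let [M] be the semidefinite matrix of [boundary_eigenvector], an arrowhead by
    [arrow_pencil].  If a diagonal entry [l - 2 Re (u a_j)] is zero, the standard
    basis vector there lies in the kernel of [M], against [coupling_neq0].  As
    these entries are positive, the rows of [M x = 0] determine [x] from its last
    entry. *)
Lemma boundary_vector a b c an x :
  (forall j, hull_boundary_indices a j -> `|b j| != `|c j|) ->
  inner x x = 1 ->
  boundary (numerical_range (arrowhead a b c an)) (qform (arrowhead a b c an) x) ->
  exists u l, [/\ u != 0, forall j, 2 * rRe (u * a j) < l,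
    x (rshift m 0) 0 != 0 &
    forall j, toC (l - 2 * rRe (u * a j)) * x (lshift 1 j) 0 =
      coupling u (b j) (c j) * x (rshift m 0) 0].
Proof.
move=> bcne x1 /(boundary_eigenvector x1)[u [l]].
rewrite arrow_pencil; set M := arrowhead _ _ _ _ => -[u0 Mh Mge Mx].
have edge y : M *m y = 0 -> forall j,
    toC (l - 2 * rRe (u * a j)) * y (lshift 1 j) 0 =
      coupling u (b j) (c j) * y (rshift m 0) 0.
  move=> My j; have := congr1 (fun Z : 'cV[R[i]]_(m + 1) => Z (lshift 1 j) 0) My.
  by rewrite arrow_mul_body mxE mulNr => /subr0_eq.
pose e j : 'cV[R[i]]_(m + 1) := delta_mx (lshift 1 j) 0.
have e_body j k : e j (lshift 1 k) 0 = (k == j)%:R.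
  by rewrite mxE eqxx andbT (inj_eq (@lshift_inj _ _)).
have e_tip j : e j (rshift m 0) 0 = 0.
  by rewrite mxE eq_rlshift.
have Me j : qform M (e j) = toC (l - 2 * rRe (u * a j)).
  rewrite /qform inner_arrow e_tip conjC0 mulr0 addr0 (bigD1 j)//= big1 ?addr0.
    by rewrite arrow_mul_body e_tip e_body eqxx conjC1 !mulr1 mulr0 addr0.
  by move=> k kj; rewrite e_body (negbTE kj) conjC0 mulr0.
have le_l j : 2 * rRe (u * a j) <= l.
  by have := Mge (e j); rewrite Me ler0c subr_ge0.
have lt_l j : 2 * rRe (u * a j) < l.
  rewrite lt_neqAle le_l andbT; apply/eqP => al.
  have : coupling u (b j) (c j) != 0.
    apply: coupling_neq0 => //; apply: bcne; apply: (hull_boundary_of_max u0).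
    by move=> k; have := le_l k; rewrite -al ler_pM2l.
  have Me0 : M *m e j = 0.
    by apply: psd_kernel => //; rewrite Me al subrr.
  have := congr1 (fun Z : 'cV[R[i]]_(m + 1) => Z (rshift m 0) 0) Me0.
  rewrite arrow_mul_tip e_tip mulr0 addr0 mxE (bigD1 j)//= big1 ?addr0.
    rewrite e_body eqxx mulr1 => /eqP.
    by rewrite oppr_eq0 conjC_eq0 => ->.
  by move=> k kj; rewrite e_body (negbTE kj) mulr0.
exists u, l; split => //; last exact: edge.
apply/eqP => xn; have /eqP := x1.
rewrite inner_arrow xn mul0r addr0 big1 => [|j _].
  by rewrite eq_sym oner_eq0.
have /eqP := edge _ Mx j; rewrite xn mulr0 mulf_eq0.
rewrite -(rmorph0 (real_complex R)) (inj_eq (@complexI R)) subr_eq0.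
by rewrite gt_eqF//= rmorph0 => /eqP ->; rewrite mul0r.
Qed.

Lemma coupling_scale (s : R) u (bj cj : R[i]) :
  coupling (toC s * u) bj cj = toC s * coupling u bj cj.
Proof.
by rewrite /coupling -!mulrA [(toC s * _)^*]rmorphM /= conj_toC mulrDr.
Qed.

(** Orthogonality of [x] and [y] makes a weighted sum [S] of the products
    [coupling u _ _ * conj (coupling v _ _)] equal to [-1].  Its imaginary part
    shows that [u conj v] is real, its real part that it is not positive. *)
Lemma orthogonal_directions a b c u v (l l' : R) x y :
  (forall w : 'I_m -> R, (forall j, 0 < w j) ->
    \sum_j w j * (sqmod (b j) - sqmod (c j)) != 0) ->
  u != 0 -> v != 0 ->
  (forall j, 2 * rRe (u * a j) < l) -> (forall j, 2 * rRe (v * a j) < l') ->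
  x (rshift m 0) 0 != 0 -> y (rshift m 0) 0 != 0 ->
  (forall j, toC (l - 2 * rRe (u * a j)) * x (lshift 1 j) 0 =
     coupling u (b j) (c j) * x (rshift m 0) 0) ->
  (forall j, toC (l' - 2 * rRe (v * a j)) * y (lshift 1 j) 0 =
     coupling v (b j) (c j) * y (rshift m 0) 0) ->
  inner x y = 0 -> u * v^* < 0.
Proof.
move=> bc u0 v0 lu lv x0 y0 xE yE xy0.
pose D j := l - 2 * rRe (u * a j); pose E j := l' - 2 * rRe (v * a j).
have D0 j : 0 < D j by rewrite subr_gt0.
have E0 j : 0 < E j by rewrite subr_gt0.
pose w j := (D j * E j)^-1.
have w0 j : 0 < w j by rewrite invr_gt0 mulr_gt0.
pose S := \sum_j toC (w j) * (coupling u (b j) (c j) * (coupling v (b j) (c j))^*).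
have S1 : S = - 1.
  have DC j : toC (D j) != 0.
    by rewrite -(rmorph0 (real_complex R)) (inj_eq (@complexI R)) gt_eqF.
  have EC j : toC (E j) != 0.
    by rewrite -(rmorph0 (real_complex R)) (inj_eq (@complexI R)) gt_eqF.
  have xyE j : x (lshift 1 j) 0 * (y (lshift 1 j) 0)^* =
      x (rshift m 0) 0 * (y (rshift m 0) 0)^* *
      (toC (w j) * (coupling u (b j) (c j) * (coupling v (b j) (c j))^*)).
    have -> : x (lshift 1 j) 0 =
        (toC (D j))^-1 * (coupling u (b j) (c j) * x (rshift m 0) 0).
      by rewrite -xE mulKf.
    have -> : y (lshift 1 j) 0 =
        (toC (E j))^-1 * (coupling v (b j) (c j) * y (rshift m 0) 0).
      by rewrite -yE mulKf.
    have -> : toC (w j) = (toC (D j))^-1 * (toC (E j))^-1.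
      by rewrite /w fmorphV rmorphM invfM.
    rewrite !rmorphM /= fmorphV /= conj_toC.
    move: (_^-1) (_^-1) (_^*) (_^*) (coupling _ _ _) => p q r s t.
    by move: (x _ _) => z; ring.
  have := xy0; rewrite inner_arrow (eq_bigr _ (fun j _ => xyE j)) -mulr_sumr -/S.
  rewrite -[X in _ + X]mulr1 -mulrDr => /eqP; rewrite mulf_eq0.
  rewrite mulf_eq0 conjC_eq0 (negbTE x0) (negbTE y0) /= addr_eq0.
  by move/eqP.
have ReS : rRe S = \sum_j w j *
    rRe (coupling u (b j) (c j) * (coupling v (b j) (c j))^*).
  rewrite /S; elim/big_rec2: _ => // j p q _ <-.
  by rewrite ReD ReZ.
have ImS : rIm S = rIm (u * v^*) * \sum_j w j * (sqmod (b j) - sqmod (c j)).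
  rewrite mulr_sumr /S; elim/big_rec2: _ => // j p q _ <-.
  by rewrite ImD ImZ coupling_cross_Im mulrCA.
have uvIm : rIm (u * v^*) = 0.
  apply/eqP; move: ImS; rewrite S1 /= oppr0 => /esym/eqP.
  by rewrite mulf_eq0 (negbTE (bc w w0)) orbF.
have /complex_realP[r rE] : u * v^* \is Num.real.
  by case: (u * v^*) uvIm => p q /= ->; rewrite complex_real.
have r0 : r != 0.
  apply/eqP => r0; have /eqP := rE; rewrite r0 rmorph0 mulf_eq0 conjC_eq0.
  by rewrite (negbTE u0) (negbTE v0).
rewrite rE -(rmorph0 (real_complex R)) ltcR ltNge; apply/negP => rge.
have {r0 rge}r0 : 0 < r by rewrite lt_def r0.
pose N := sqmod v; have N0 : 0 < N by exact: sqmod_gt0.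
have uE : u = toC (r / N) * v.
  have -> : toC (r / N) = u * v^* / (v * v^*).
    by rewrite rE rmorphM fmorphV /= sqmodE normCK.
  by rewrite invfM mulrACA mulfV ?conjC_eq0// mulr1 divfK.
have : 0 <= rRe S.
  rewrite ReS sumr_ge0// => j _; apply: mulr_ge0; first exact: ltW.
  rewrite {1}uE coupling_scale -mulrA ReZ mulr_ge0//.
    by rewrite divr_ge0 ?ltW.
  by have := mul_conjC_ge0 (coupling v (b j) (c j)); rewrite lecE => /andP[].
by rewrite S1 /= oppr_ge0 ler10.
Qed.

(** The product of the three numbers [u conj v], [v conj w], [w conj u] is
    [|u|^2 |v|^2 |w|^2], which is nonnegative, so they are not all negative. *)
Lemma opposite_directions_triple u v w :
  u * v^* < 0 -> v * w^* < 0 -> u * w^* < 0 -> False.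
Proof.
move=> uv vw uw.
have : 0 < (u * v^*) * (v * w^*) by rewrite nmulr_rgt0.
have wu : w * u^* < 0.
  have := uw; rewrite -oppr_gt0 => /gtr0_real/CrealP; rewrite rmorphN rmorphM /=.
  by rewrite conjCK [w * _]mulrC => /oppr_inj ->.
rewrite -(nmulr_llt0 _ wu) => /lt_geF/negP; apply.
have -> : u * v^* * (v * w^*) * (w * u^*) = (u * u^*) * (v * v^*) * (w * w^*).
  by move: (u^*) (v^*) (w^*) => u' v' w'; ring.
by apply: mulr_ge0; [apply: mulr_ge0|]; exact: mul_conjC_ge0.
Qed.

Lemma hull_boundary_nonempty a (j0 : 'I_m) : exists j, hull_boundary_indices a j.
Proof.
pose j := [arg max_(j > j0) rRe (a j)]%O.
exists j; apply: (@hull_boundary_of_max _ _ 1); first exact: oner_neq0.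
by move=> k; rewrite !mul1r /j; case: arg_maxP => //= i _ /(_ k); apply.
Qed.

Lemma sqmod_le (z z' : R[i]) : `|z| <= `|z'| -> sqmod z <= sqmod z'.
Proof. by move=> h; rewrite -lecR !sqmodE ler_sqr ?nnegrE. Qed.

Lemma sqmod_lt (z z' : R[i]) : `|z| < `|z'| -> sqmod z < sqmod z'.
Proof. by move=> h; rewrite -ltcR !sqmodE ltr_sqr ?nnegrE. Qed.

Lemma weighted_gap_gt0 a b c (w : 'I_m -> R) :
  (0 < m)%N -> (forall j, 0 < w j) ->
  (forall j, `|c j| <= `|b j|) ->
  (forall j, hull_boundary_indices a j -> `|c j| < `|b j|) ->
  0 < \sum_j w j * (sqmod (b j) - sqmod (c j)).
Proof.
move=> m0 w0 le lt; have [j /lt ltj] := hull_boundary_nonempty a (Ordinal m0).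
rewrite (bigD1 j)//= ltr_pwDl ?mulr_gt0 ?subr_gt0 ?sqmod_lt//.
by rewrite sumr_ge0// => k _; rewrite mulr_ge0 ?subr_ge0 ?sqmod_le// ltW.
Qed.

End Arrowhead.

Theorem theorem11 (R : realType) (m : nat) (hn : (3 <= m + 1)%N)
    (a b c : 'I_m -> R[i]) (an : R[i]) (ha : injective a)
    (hbc : ((forall j, `|c j| <= `|b j|) /\
            (forall j, hull_boundary_indices a j -> `|c j| < `|b j|)) \/
           ((forall j, `|b j| <= `|c j|) /\
            (forall j, hull_boundary_indices a j -> `|b j| < `|c j|))) :
  gau_wu_number (arrowhead a b c an) = 2%N.
Proof.
have m0 : (0 < m)%N by move: hn; case: (m).
have [famk kmax] := gau_wu_numberP (arrowhead a b c an).
apply/eqP; rewrite eqn_leq; apply/andP; split; last first.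
  by apply/kmax/boundary_family2; exact: ltnW.
rewrite leqNgt; apply/negP => k3; move: famk k3.
move: (gau_wu_number _) => k [x [xo xb]] k3.
have bc_ne j : hull_boundary_indices a j -> `|b j| != `|c j|.
  by move=> hj; case: hbc => -[_ /(_ j hj) lt]; [rewrite gt_eqF | rewrite lt_eqF].
have bc w : (forall j, 0 < w j) -> \sum_j w j *
    (sqmod (b j) - sqmod (c j)) != 0.
  move=> w0; case: hbc => -[le lt].
    by rewrite gt_eqF// (weighted_gap_gt0 m0 w0 le lt).
  rewrite -oppr_eq0 -sumrN.
  under eq_bigr do rewrite -mulrN opprB.
  by rewrite gt_eqF// (weighted_gap_gt0 m0 w0 le lt).
pose i0 : 'I_k := Ordinal (ltn_trans (ltn_trans (ltnSn 0) (ltnSn 1)) k3).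
pose i1 : 'I_k := Ordinal (ltn_trans (ltnSn 1) k3).
pose i2 : 'I_k := Ordinal k3.
have unit i : inner (x i) (x i) = 1 by rewrite xo eqxx.
have [u0 [l0 [nu0 lt0 tip0 edge0]]] := boundary_vector bc_ne (unit i0) (xb i0).
have [u1 [l1 [nu1 lt1 tip1 edge1]]] := boundary_vector bc_ne (unit i1) (xb i1).
have [u2 [l2 [nu2 lt2 tip2 edge2]]] := boundary_vector bc_ne (unit i2) (xb i2).
apply: (@opposite_directions_triple R u0 u1 u2).
- by apply: (orthogonal_directions bc nu0 nu1 lt0 lt1 tip0 tip1 edge0 edge1).
- by apply: (orthogonal_directions bc nu1 nu2 lt1 lt2 tip1 tip2 edge1 edge2).
- by apply: (orthogonal_directions bc nu0 nu2 lt0 lt2 tip0 tip2 edge0 edge2).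
Qed.
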